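(* Let $w\in\mathfrak{S}_n$ be a product of distinct simple transpositions (i.e. $w=s_{l_1}\cdots s_{l_r}$ with $l_1,\dots,l_r$ pairwise distinct). Then $Q_{v,w}$ is combinatorially equivalent to a cube for every $v\in\mathfrak{S}_n$ with $v<w$. In particular, if $v,w\in\mathfrak{S}_n$ satisfy $w=vs_{j_1}s_{j_2}\cdots s_{j_m}$ with $\ell(w)-\ell(v)=m$ and $j_1,\dots,j_m$ distinct, and $v$ has a reduced expression $s_{i_1}s_{i_2}\cdots s_{i_\ell}$ such that $i_1,\dots,i_\ell,j_1,\dots,j_m$ are all distinct, then $Q_{v,w}$ is combinatorially equivalent to a cube.
   Context: $\mathfrak{S}_n$ is the symmetric group on $\{1,\dots,n\}$ with product given by composition, $s_i=(i,i+1)$ for $1\le i\le n-1$ are the simple transpositions, $\ell(\cdot)$ is the length with respect to them, and $\le$ is Bruhat order. For $v\le w$, the Bruhat interval polytope $Q_{v,w}$ is the convex hull in $\mathbb{R}^n$ of the points $(z(1),\dots,z(n))$ for $z\in\mathfrak{S}_n$ with $v\le z\le w$. Two polytopes are combinatorially equivalent if their face posets are isomorphic. *)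

(* Defs.v *)
From HB Require Import structures.
From mathcomp Require Import all_boot all_order all_fingroup all_algebra.
From mathcomp Require Import boolp classical_sets functions reals convex.
Set Implicit Arguments.
Unset Strict Implicit.
Unset Printing Implicit Defensive.
Import Order.TTheory GRing.Theory Num.Theory.
Local Open Scope classical_set_scope.
Local Open Scope ring_scope.

(* Permutations of {1, ..., n} are elements of 'S_n: the ordinal i : 'I_n     *)
(* stands for the integer i + 1.                                              *)

(* The product of MathComp's 'S_n is (u * v) x = v (u x); compp is the        *)
(* opposite one, that is, the usual composition of functions (comppE).        *)
Definition compp (n : nat) (u v : 'S_n) : 'S_n := (v * u)%g.

Lemma comppE n (u v : 'S_n) x : compp u v x = u (v x).
Proof. exact: permM. Qed.

Lemma simple_subproof n (i : 'I_n.-1) : (i.+1 < n)%N.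
Proof. by rewrite -ltn_predRL. Qed.

(* i : 'I_n.-1 stands for the index i + 1 of a simple transposition.          *)
Definition simple (n : nat) (i : 'I_n.-1) : 'S_n :=
  tperm (Ordinal (ltnW (simple_subproof i))) (Ordinal (simple_subproof i)).

(* word_prod [:: l1; ...; lr] = s_l1 s_l2 ... s_lr *)
Definition word_prod (n : nat) (ls : seq 'I_n.-1) : 'S_n :=
  foldr (fun i u => compp (simple i) u) 1%g ls.

Definition has_word (n : nat) (w : 'S_n) (k : nat) : bool :=
  [exists t : k.-tuple 'I_n.-1, word_prod t == w].

Lemma word_prod_cat n (s t : seq 'I_n.-1) :
  word_prod (s ++ t) = compp (word_prod s) (word_prod t).
Proof.
by elim: s => [|i s IH]; rewrite /= /compp ?mulg1 // IH /compp mulgA.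
Qed.

Lemma word_prod_tperm n (a b : 'I_n) :
  exists s : seq 'I_n.-1, word_prod s = tperm a b.
Proof.
wlog: a b / (a <= b)%N => [H|].
  by case: (leqP a b) => [/H //|/ltnW/H]; rewrite tpermC.
move eqk : (b - a)%N => k; elim: k b eqk => [|k IH] b eqk leab.
  have -> : b = a by apply/val_inj/eqP; rewrite eqn_leq leab -subn_eq0 eqk.
  by exists [::]; rewrite /= tperm1.
have ltab : (a < b)%N by rewrite -subn_gt0 eqk.
have b0 : (0 < b)%N by apply: leq_ltn_trans ltab.
have cP : (b.-1 < n.-1)%N by rewrite ltn_predRL prednK.
have c'P : (b.-1 < n)%N by apply: leq_ltn_trans (ltn_ord b); exact: leq_pred.
case: (IH (Ordinal c'P)) => /= [||s sE].
- by rewrite -subn1 subnAC eqk subn1.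
- by rewrite -ltnS prednK.
pose i := Ordinal cP.
have iE : simple i = tperm (Ordinal c'P) b.
  by rewrite /simple; congr tperm; apply: val_inj => //=; rewrite prednK.
case: k eqk IH => [|k] eqk IH.
  exists [:: i]; rewrite /= /compp mul1g iE; congr tperm; apply: val_inj => /=.
  by rewrite -(subnK leab) eqk.
exists (i :: rcons s i).
rewrite -cats1 /= word_prod_cat /= /compp mul1g sE iE.
rewrite -{1}(tpermV (Ordinal c'P) b) -mulgA -/(conjg _ _) tpermJ tpermL.
rewrite tpermD //; apply/eqP => /(congr1 val) /= eqa.
  by move: eqk; rewrite -eqa -{1}(prednK b0) subSnn.
by move: ltab; rewrite eqa ltnn.
Qed.

Lemma has_wordP n (w : 'S_n) : exists k, has_word w k.
Proof.
suff [s sE] : exists s : seq 'I_n.-1, word_prod s = w.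
  by exists (size s); apply/existsP; exists (in_tuple s); rewrite sE.
case: (prod_tpermP w) => ts -> _; elim: ts => [|t ts [s IH]].
  by exists [::]; rewrite big_nil.
have [s' s'E] := word_prod_tperm t.1 t.2.
by exists (s ++ s'); rewrite word_prod_cat IH s'E big_cons.
Qed.

Definition ell (n : nat) (w : 'S_n) : nat := ex_minn (has_wordP w).

Definition reduced_expr (n : nat) (w : 'S_n) (ls : seq 'I_n.-1) : Prop :=
  w = word_prod ls /\ size ls = ell w.

(* Bruhat order: the reflexive transitive closure of u -> u t, where t is a   *)
(* transposition and the length increases.                                    *)
Definition bruhat_step (n : nat) : rel 'S_n := fun u v =>
  [exists i, exists j, (i != j) && (v == compp u (tperm i j))]
    && (ell u < ell v)%N.

Definition bruhat_le (n : nat) : rel 'S_n := connect (@bruhat_step n).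

Definition bruhat_lt (n : nat) : rel 'S_n :=
  fun u v => (u != v) && bruhat_le u v.

Definition convex_hull (R : realType) (n : nat) (A : set 'rV[R]_n) : set 'rV[R]_n :=
  smallest (@convex_set R 'rV[R]_n) A.

Definition perm_point (R : realType) (n : nat) (z : 'S_n) : 'rV[R]_n :=
  \row_(i < n) (z i).+1%:R.

Definition bruhat_polytope (R : realType) (n : nat) (v w : 'S_n) : set 'rV[R]_n :=
  convex_hull [set perm_point R z | z in
    [set z : 'S_n | bruhat_le v z && bruhat_le z w]].
Arguments bruhat_polytope R {n} v w.

(* The faces of P, including P itself and the empty face: the intersections   *)
(* of P with {x | <c, x> = b} for the inequalities <c, x> <= b valid on P.    *)
Definition faces (R : realType) (n : nat) (P : set 'rV[R]_n) : set (set 'rV[R]_n) :=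
  [set F | exists (c : 'rV[R]_n) (b : R),
     (forall x, P x -> \sum_(i < n) c 0 i * x 0 i <= b) /\
     F = P `&` [set x | \sum_(i < n) c 0 i * x 0 i = b]].

Definition comb_equiv (R : realType) (m n : nat)
    (P : set 'rV[R]_m) (Q : set 'rV[R]_n) : Prop :=
  exists f : set 'rV[R]_m -> set 'rV[R]_n,
    set_bij (faces P) (faces Q) f /\
    (forall F G, faces P F -> faces P G -> (F `<=` G <-> f F `<=` f G)).

Definition cube (R : realType) (d : nat) : set 'rV[R]_d :=
  [set x | forall i, 0 <= x 0 i <= 1].
Arguments cube R d : clear implicits.

Definition comb_equiv_cube (R : realType) (n : nat) (P : set 'rV[R]_n) : Prop :=
  exists d : nat, comb_equiv P (cube R d).

(* Main.v *)
Require Import Defs.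
From mathcomp Require Import all_boot all_order all_fingroup all_algebra.
From mathcomp Require Import interval_inference boolp classical_sets functions.
From mathcomp Require Import reals convex.
From mathcomp Require Import zify ring lra.
Set Implicit Arguments.
Unset Strict Implicit.
Unset Printing Implicit Defensive.
Import Order.TTheory GRing.Theory Num.Theory.

(** Let w be the product of a word ls of distinct letters and v <= w the
product of a subword vs.

Combinatorics. Deleting a letter is the only way to go down a Bruhat step
(word_deletion), so everything below w is the product of a subword of ls.
A product of distinct letters determines its letters: the letter i occurs if
and only if the permutation does not preserve the set of the first positions
up to i (word_prod_letters). Hence the interval from v to w is a Boolean
lattice: its elements z_S are the products of the letters of ls that lie in
vs or in S, where S ranges over the sets of letters and only the trace of S
on K, the letters of ls outside vs, matters (bruhat_interval_word).

Geometry. The points of the interval satisfy a certificate (cubical) that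
mimics the vertices of a cube. It has two parts. The edges at the vertex p S
go to the vertices p (S +- k) for k in K, and the vector from p S to any
p T is a positive combination of exactly those edges whose k separates S from
T. For each k in K, the points with k in S, and those with k not in S, are
each cut out by a valid inequality. Such a certificate determines the face
lattice: if an inequality is tight at p S, then by the first part it is tight
at p T if and only if it is tight at the end of each of the edges involved, so
that the tight vertices form a subcube (tight_subcube); conversely, adding up
inequalities of the second part shows that every subcube occurs
(subcube_tight). Since a face is the hull of its vertices (hull_face), two
families certified for the same K span combinatorially equivalent polytopes
(comb_equiv_cubical), and the vertices of the standard cube are certified for
every K (cubical_cube).

It remains to certify the points of z_S, which is done by induction on ls,
removing its last letter i (cubical_word). Right multiplication by s_i swaps
the coordinates i and i+1. If i is in vs, this is a linear isomorphism applied
to all points. Otherwise the new family consists of the old points x and of the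
points x + (x_(i+1) - x_i) (e_i - e_(i+1)). As i does not occur in the rest of
the word, the old permutations preserve the first i positions, so that the
factor x_(i+1) - x_i is positive and the sum of the first i coordinates is
constant on the old points. The new polytope is thus a prism, possibly with non-parallel
bases, over the old one, and the certificate extends (cubical_prism). *)

(** * Supports and subwords *)

Definition lo n (i : 'I_n.-1) : 'I_n := Ordinal (ltnW (simple_subproof i)).
Definition hi n (i : 'I_n.-1) : 'I_n := Ordinal (simple_subproof i).

(** The positions 0, ..., i are permuted among themselves, that is, the permutation
lies in the parabolic subgroup generated by the letters other than i. *)
Definition initial_stable n (i : 'I_n.-1) (z : 'S_n) := forall x, (z x <= i) = (x <= i).

Lemma initial_stable_simple n (i k : 'I_n.-1) : k != i -> initial_stable i (simple k).
Proof.
move=> ki x; have {}ki : (k : nat) != i by [].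
by rewrite /simple; case: tpermP => [->|->|//] /=; rewrite [in k < i]ltn_neqAle ki.
Qed.

Lemma initial_stable_word n (i : 'I_n.-1) ls : i \notin ls -> initial_stable i (word_prod ls).
Proof.
elim: ls => [_ x|k s IH]; first by rewrite perm1.
rewrite inE negb_or => /andP[ik /IH sI] x.
by rewrite /= comppE initial_stable_simple ?sI // eq_sym.
Qed.

(** Write the word as s i t. Neither s nor t moves a position across the gap
between i and i+1, so the position that t sends to i is carried across it. *)
Lemma not_initial_stable_word n (i : 'I_n.-1) ls :
  uniq ls -> i \in ls -> ~ initial_stable i (word_prod ls).
Proof.
move=> uls ils; case/splitPr: ils uls => p1 p2.
rewrite cat_uniq /= negb_or -!andbA => /and5P[_ ip1 _ ip2 _] st.
pose x := (word_prod p2)^-1%g (lo i).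
have px : word_prod p2 x = lo i by rewrite permKV.
have := st x; rewrite word_prod_cat /= !comppE px tpermL.
rewrite (initial_stable_word ip1) -(initial_stable_word ip2 x) px /= leqnn.
by rewrite leqNgt ltnS leqnn.
Qed.

Lemma ell_le n (ls : seq 'I_n.-1) : ell (word_prod ls) <= size ls.
Proof.
rewrite /ell; case: ex_minnP => m _; apply.
by apply/existsP; exists (in_tuple ls).
Qed.

Lemma ell_word n (w : 'S_n) : exists2 ls, word_prod ls = w & size ls = ell w.
Proof.
rewrite /ell; case: ex_minnP => m /existsP[t /eqP tE] _.
by exists t => //; rewrite size_tuple.
Qed.

(** Whether the letter i occurs is read off from the permutation, because t has to
break the stability of {0, ..., i} as s does. *)
Lemma word_prod_letters n (s t : seq 'I_n.-1) :
  uniq s -> word_prod s = word_prod t -> {subset s <= t}.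
Proof.
move=> us st i si; apply/negPn/negP => /initial_stable_word; rewrite -st.
exact: not_initial_stable_word.
Qed.

(** By the previous lemma every other word for the same permutation contains these
distinct letters, so it cannot be shorter. *)
Lemma ell_uniq n (ls : seq 'I_n.-1) : uniq ls -> ell (word_prod ls) = size ls.
Proof.
move=> us; apply/eqP; rewrite eqn_leq ell_le /=.
have [ts tE <-] := ell_word (word_prod ls).
by apply: uniq_leq_size => //; apply: word_prod_letters.
Qed.

(** The exchange property. Reading the word from the right, the order of the
images of a and b is reversed at some letter; that letter exchanges
exactly the current images of a and b, so deleting it amounts to composing
with the transposition (a b) first. *)
Lemma word_deletion n (ls : seq 'I_n.-1) (a b : 'I_n) :
  a < b -> word_prod ls b < word_prod ls a ->
  exists ls', [/\ subseq ls' ls, (size ls').+1 = size ls &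
                  compp (word_prod ls) (tperm a b) = word_prod ls'].
Proof.
move=> ab; elim: ls => [|k s IH] /=.
  by rewrite !perm1 => /(ltn_trans ab); rewrite ltnn.
rewrite !comppE; set y := word_prod s in IH *.
case: (ltngtP (y a) (y b)) => [lt|/IH[s' [ss sz E]] _|/val_inj/perm_inj eab]; last first.
- by rewrite eab ltnn in ab.
- exists (k :: s'); split; rewrite /= ?eqxx ?sz //.
  by rewrite -E /compp mulgA.
(* The letter k reverses y a < y b, so it is the transposition of y a and y b. *)
move=> gt; exists s; split=> //; first exact: (subseq_cons s k).
suff kE : simple k = tperm (y a) (y b).
  by rewrite /compp kE -tpermJ conjgE mulKVg mulgA tperm2 mul1g.
move: gt; rewrite /simple -/(lo k) -/(hi k).
case: (tpermP _ _ (y b)) => [yb|yb|_ _]; case: (tpermP _ _ (y a)) => [ya|ya|ya ya'] //=;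
  move: lt; rewrite ?ya ?yb /=; by [|lia].
Qed.


(** Let w be the product of ls and w = u (i j) with i < j. If w i > w j, delete a
letter of ls. Otherwise u i > u j, and deleting a letter from a shortest
word of u makes w shorter than u, which is excluded. *)
Lemma bruhat_step_word n (u : 'S_n) (ls : seq 'I_n.-1) :
  bruhat_step u (word_prod ls) ->
  exists2 ls', subseq ls' ls & u = word_prod ls'.
Proof.
case/andP=> /existsP[i /existsP[j /andP[]]]; wlog ij : i j / i < j => [H|].
  case: (ltngtP i j) => [/H //|/H + + +|/val_inj-> /eqP //].
  by rewrite tpermC eq_sym; apply.
move=> _ /eqP zE lt.
have uE : u = compp (word_prod ls) (tperm i j).
  by rewrite zE /compp mulgA tperm2 mul1g.
case: (ltngtP (word_prod ls i) (word_prod ls j)) => [zij|zji|/val_inj/perm_inj eij].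
- have [us usE usz] := ell_word u.
  have uji : word_prod us j < word_prod us i by rewrite usE uE !comppE tpermL tpermR.
  have [us' [_ sz E]] := word_deletion ij uji.
  move: lt; rewrite zE -usE E ltnNge => /negP[].
  by apply: leq_trans (ell_le _) _; rewrite usE -usz -sz.
- have [ls' [ss _ E]] := word_deletion ij zji.
  by exists ls'; rewrite ?uE.
- by rewrite eij ltnn in ij.
Qed.

Lemma bruhat_le_word n (u : 'S_n) (ls : seq 'I_n.-1) :
  bruhat_le u (word_prod ls) ->
  exists2 ls', subseq ls' ls & u = word_prod ls'.
Proof.
case/connectP=> p; elim/last_ind: p ls => [|p w IH] ls /=.
  by move=> _ wE; exists ls.
rewrite rcons_path last_rcons => /andP[pp st] wE.
rewrite -wE in st; have [ls1 ss1 E1] := bruhat_step_word st.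
have [ls2 ss2 E2] := IH ls1 pp (esym E1).
by exists ls2 => //; apply: subseq_trans ss1.
Qed.

(** The inserted letter becomes a transposition on the right after conjugation
by the product of t; both words have distinct letters, so their lengths are
known. *)
Lemma bruhat_step_insert n (s t : seq 'I_n.-1) k :
  uniq (s ++ k :: t) -> bruhat_step (word_prod (s ++ t)) (word_prod (s ++ k :: t)).
Proof.
move=> us; have us' : uniq (s ++ t).
  by apply: subseq_uniq us; rewrite cat_subseq ?subseq_cons.
apply/andP; split; last by rewrite !ell_uniq // !size_cat /= addnS.
set y := (word_prod t)^-1%g.
apply/existsP; exists (y (lo k)); apply/existsP; exists (y (hi k)).
apply/andP; split; first by rewrite (inj_eq perm_inj) neq_ltn /= ltnSn.
by rewrite !word_prod_cat /= /compp -tpermJ conjgE invgK /y !mulgA mulgKV.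
Qed.

(** The common prefix s lets the induction on ls pass over a letter that is kept. *)
Lemma subseq_bruhat_le n (s ls' ls : seq 'I_n.-1) :
  subseq ls' ls -> uniq (s ++ ls) ->
  bruhat_le (word_prod (s ++ ls')) (word_prod (s ++ ls)).
Proof.
elim: ls ls' s => [|k ls IH] ls' s.
  by rewrite subseq0 => /eqP-> _; exact: connect0.
have skip : subseq ls' ls -> uniq (s ++ k :: ls) ->
    bruhat_le (word_prod (s ++ ls')) (word_prod (s ++ k :: ls)).
  move=> ss us; apply: connect_trans (IH _ _ ss _) (connect1 (bruhat_step_insert us)).
  by apply: subseq_uniq us; rewrite cat_subseq ?subseq_cons.
case: ls' skip => [|h ls'] skip; first by move=> _; apply: skip; apply: sub0seq.
rewrite /=; case: (h =P k) => [-> ss|_ //].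
by rewrite -!cat_rcons; apply: IH.
Qed.

(** A subword between vs and ls is cut out of ls by its set of letters, and it
contains the letters of vs because these depend on the permutation only. *)
Lemma bruhat_interval_word n (vs ls : seq 'I_n.-1) (z : 'S_n) :
  uniq ls -> subseq vs ls ->
  bruhat_le (word_prod vs) z && bruhat_le z (word_prod ls) <->
  exists S : {set 'I_n.-1},
    z = word_prod [seq i <- ls | (i \in vs) || (i \in S)].
Proof.
move=> us ssv; split=> [/andP[vz /bruhat_le_word[zs ssz zE]]|[S ->]].
  have uz := subseq_uniq ssz us.
  rewrite zE in vz; have [vs' ssv' vE] := bruhat_le_word vz.
  have sub : {subset vs <= zs}.
    move=> i /(word_prod_letters (subseq_uniq ssv us) vE); exact: (mem_subseq ssv').
  exists [set i in zs]; rewrite zE {1}(subseq_uniqP us ssz); congr word_prod.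
  by apply: eq_filter => i; rewrite inE; case: (boolP (i \in vs)) => [/sub ->|].
apply/andP; split; apply: (@subseq_bruhat_le _ [::]); rewrite ?filter_uniq ?filter_subseq //.
by rewrite subseq_filter ssv andbT; apply/allP => i ->.
Qed.

(** * Faces of the convex hull of a finite family *)

Section Hulls.
Local Open Scope classical_set_scope.
Local Open Scope ring_scope.
Variables (R : realType) (n : nat).
Implicit Types (c x y : 'rV[R]_n) (b : R).

Definition dot c x : R := \sum_(i < n) c 0 i * x 0 i.

Lemma dotC c x : dot c x = dot x c.
Proof. by apply: eq_bigr => i _; rewrite mulrC. Qed.

Lemma dotDr c x y : dot c (x + y) = dot c x + dot c y.
Proof. by rewrite -big_split; apply: eq_bigr => i _; rewrite mxE mulrDr. Qed.

Lemma dotZr c a x : dot c (a *: x) = a * dot c x.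
Proof. by rewrite mulr_sumr; apply: eq_bigr => i _; rewrite mxE mulrCA. Qed.

Lemma dotNr c x : dot c (- x) = - dot c x.
Proof. by rewrite -scaleN1r dotZr mulN1r. Qed.

Lemma dotBr c x y : dot c (x - y) = dot c x - dot c y.
Proof. by rewrite dotDr dotNr. Qed.

Lemma dot0r c : dot c 0 = 0.
Proof. by rewrite -(scale0r 0) dotZr mul0r. Qed.

Lemma dot_sumr c (I : Type) (r : seq I) (P : pred I) (F : I -> 'rV[R]_n) :
  dot c (\sum_(i <- r | P i) F i) = \sum_(i <- r | P i) dot c (F i).
Proof. by apply: (big_morph (dot c)) => [x y|]; rewrite ?dotDr ?dot0r. Qed.

Lemma dotDl c c' x : dot (c + c') x = dot c x + dot c' x.
Proof. by rewrite dotC dotDr !(dotC x). Qed.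

Lemma dotZl a c x : dot (a *: c) x = a * dot c x.
Proof. by rewrite dotC dotZr (dotC x). Qed.

Lemma dotNl c x : dot (- c) x = - dot c x.
Proof. by rewrite dotC dotNr (dotC x). Qed.

Lemma dotBl c c' x : dot (c - c') x = dot c x - dot c' x.
Proof. by rewrite dotDl dotNl. Qed.

Lemma dot_suml x (I : Type) (r : seq I) (P : pred I) (F : I -> 'rV[R]_n) :
  dot (\sum_(i <- r | P i) F i) x = \sum_(i <- r | P i) dot (F i) x.
Proof. by rewrite dotC dot_sumr; apply: eq_bigr => i _; rewrite dotC. Qed.

(** Trades the weights of type {i01 R} for real numbers with explicit bounds. *)
Lemma convex_setP (A : set 'rV[R]_n) :
  convex_set (A : set (convex_lmodType 'rV[R]_n)) <->
  forall x y t, 0 <= t -> t <= 1 -> A x -> A y -> A (t *: x + (1 - t) *: y).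
Proof.
split=> [cA x y t t0 t1 Ax Ay|cA x y t /set_mem Ax /set_mem Ay].
  by have /set_mem := cA x y (Itv01 t0 t1) (mem_set Ax) (mem_set Ay).
by apply/mem_set/cA.
Qed.

Lemma convex_hull_convex (A : set 'rV[R]_n) :
  convex_set (convex_hull A : set (convex_lmodType 'rV[R]_n)).
Proof.
apply/convex_setP => x y t t0 t1 Ax Ay B [cB AB].
by move/convex_setP: (cB); apply=> //; [apply: Ax|apply: Ay].
Qed.

Lemma sub_convex_hull (A : set 'rV[R]_n) : A `<=` convex_hull A.
Proof. exact: sub_gen_smallest. Qed.

Lemma convex_hull_sub (A B : set 'rV[R]_n) :
  convex_set (B : set (convex_lmodType 'rV[R]_n)) -> A `<=` B ->
  convex_hull A `<=` B.
Proof. exact: smallest_sub. Qed.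

Variables (I : finType) (p : {set I} -> 'rV[R]_n).

Definition hull (V : {set {set I}}) := convex_hull [set p S | S in [set S | S \in V]].

Definition vertex_set (F : set 'rV[R]_n) : {set {set I}} := [set S | `[< F (p S) >]]%SET.

Lemma vertex_setP (F : set 'rV[R]_n) S : reflect (F (p S)) (S \in vertex_set F).
Proof. by rewrite inE; apply: asboolP. Qed.

Definition valid c b := forall S, dot c (p S) <= b.

Definition tight c b : {set {set I}} := [set S | dot c (p S) == b]%SET.

Lemma hull_subset (V W : {set {set I}}) : V \subset W -> hull V `<=` hull W.
Proof.
move=> /fintype.subsetP VW; apply: convex_hull_sub; first exact: convex_hull_convex.
by move=> _ [S /= /VW SW <-]; apply: sub_convex_hull; exists S.
Qed.

Lemma hull_le c b : valid c b -> forall x, hull [set: {set I}]%SET x -> dot c x <= b.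
Proof.
move=> v; apply: (@convex_hull_sub _ [set x | dot c x <= b]); last by move=> _ [S _ <-]; exact: v.
apply/convex_setP => x y t t0 t1 /= cx cy; rewrite dotDr !dotZr.
by nra.
Qed.

(** The set of the x such that dot c x < b or x is in the hull of the tight
points is convex, and it contains every p S; hence it contains the hull. This
avoids writing points as explicit convex combinations. *)
Lemma hull_face c b : valid c b ->
  hull [set: {set I}]%SET `&` [set x | dot c x = b] = hull (tight c b).
Proof.
move=> v; apply/seteqP; split=> [x [Px /= cx]|x Hx].
  suff [|//] : dot c x < b \/ hull (tight c b) x by rewrite cx ltxx.
  have heq y : hull (tight c b) y -> dot c y = b.
    apply: (@convex_hull_sub _ [set y | dot c y = b]).
      apply/convex_setP => x' y' t _ _ /= cx' cy'.
      by rewrite dotDr !dotZr cx' cy'; ring.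
    by move=> _ [S /= + <-]; rewrite inE => /eqP.
  move: x Px {cx}; apply: (@convex_hull_sub _ [set x | dot c x < b \/ hull (tight c b) x]).
    apply/convex_setP => x y t t0 t1 /= Hx Hy.
    have [->|tn0] := eqVneq t 0; first by rewrite subr0 scale0r scale1r add0r.
    have [->|tn1] := eqVneq t 1; first by rewrite subrr scale0r scale1r addr0.
    have {}t0 : 0 < t by rewrite lt_def tn0.
    have {}t1 : t < 1 by rewrite lt_def eq_sym tn1.
    case: Hx => Hx; last case: Hy => Hy.
    - left; rewrite dotDr !dotZr.
      have : dot c y <= b by case: Hy => [/ltW //|/heq ->].
      by nra.
    - by left; rewrite dotDr !dotZr (heq _ Hx); nra.
    - by right; apply: (proj1 (convex_setP _) (@convex_hull_convex _)) => //; exact: ltW.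
  move=> _ [S _ <-]; rewrite /=; have := v S; rewrite le_eqVlt => /orP[cS|]; last by left.
  by right; apply: sub_convex_hull; exists S; rewrite //= inE.
split; first exact: hull_subset (finset.subsetT _) _ Hx.
move: x Hx; apply: (@convex_hull_sub _ [set y | dot c y = b]).
  apply/convex_setP => x' y' t _ _ /= cx' cy'.
  by rewrite dotDr !dotZr cx' cy'; ring.
by move=> _ [S /= + <-]; rewrite inE => /eqP.
Qed.

Lemma facesP F :
  faces (hull [set: {set I}]%SET) F <->
  exists c b, valid c b /\ F = hull (tight c b).
Proof.
split=> [[c [b [v ->]]]|[c [b [v ->]]]]; exists c, b; split.
- by move=> S; apply: v; apply: sub_convex_hull; exists S; rewrite //= inE.
- rewrite -hull_face //; move=> S; apply: v; apply: sub_convex_hull.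
  by exists S; rewrite //= inE.
- exact: hull_le.
- by rewrite -hull_face.
Qed.

Lemma vertex_set_hull c b : valid c b -> vertex_set (hull (tight c b)) = tight c b.
Proof.
move=> v; apply/setP => S; rewrite !inE; apply/asboolP/eqP; rewrite -hull_face //.
  by case.
by split => //; apply: sub_convex_hull; exists S; rewrite //= inE.
Qed.

End Hulls.

(** * Families of points with the face lattice of a cube *)

Section Cubical.
Local Open Scope classical_set_scope.
Local Open Scope ring_scope.
Variables (R : realType) (I : finType).
Implicit Types (K E S T : {set I}) (n : nat).

Definition toggle k S : {set I} := [set j | (j == k) (+) (j \in S)]%SET.

(** E is the set of the fixed coordinates. *)
Definition subcube E S : {set {set I}} :=
  [set T : {set I} | [forall k in E, (k \in T) == (k \in S)]]%SET.

Definition is_subcube K (V : {set {set I}}) :=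
  V = finset.set0 \/ exists E S, E \subset K /\ V = subcube E S.

(** The first clause describes the cone at p S: its edges are indexed by K and they
point to the neighbours of S. The second clause provides the two opposite facets
in the direction k; e selects one of them. The sets S are not required to lie
in K: by the first clause p S depends on the trace of S on K only, which saves
side conditions throughout. *)
Definition cubical n K (p : {set I} -> 'rV[R]_n) : Prop :=
  (forall S T, exists a : I -> R, (forall k, 0 < a k) /\
     p T - p S =
     \sum_(k in K | (k \in S) != (k \in T)) a k *: (p (toggle k S) - p S)) /\
  (forall k (e : bool), k \in K -> exists c b, forall S,
     dot c (p S) <= b ?= iff ((k \in S) == e)).

(** Pair the first clause of the certificate with c: if c is maximal at p S,
all the terms of the sum are nonpositive, so the sum vanishes if and only if
each edge involved is orthogonal to c. *)
Lemma tight_subcube n K (p : {set I} -> 'rV[R]_n) c b :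
  cubical K p -> valid p c b -> is_subcube K (tight p c b).
Proof.
move=> [cone _] v; case: (set_0Vmem (tight p c b)) => [->|[S]]; first by left.
rewrite inE => /eqP cS.
right; exists [set k in K | dot c (p (toggle k S)) != b]%SET, S; split.
  by apply/fintype.subsetP => k; rewrite inE => /andP[].
apply/setP => T; rewrite !inE.
have [a [a0 /(congr1 (dot c))]] := cone S T; rewrite dotBr dot_sumr => E.
rewrite -subr_eq0 -[X in _ - X]cS {}E; apply/eqP/'forall_implyP => [E k|H].
  rewrite inE => /andP[kK ck]; apply: contraNT ck; rewrite eq_sym => kST.
  have F0 : forall i, (i \in K) && ((i \in S) != (i \in T)) ->
      0 <= - dot c (a i *: (p (toggle i S) - p S)).
    by move=> i _; rewrite dotZr dotBr cS -mulrN pmulr_rge0 // opprB subr_ge0.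
  have E' : \sum_(i in K | (i \in S) != (i \in T)) - dot c (a i *: (p (toggle i S) - p S)) = 0.
    by rewrite sumrN E oppr0.
  have /eqP := psumr_eq0P F0 E' (introT andP (conj kK kST)).
  by rewrite oppr_eq0 dotZr mulf_eq0 gt_eqF //= dotBr cS subr_eq0.
rewrite big1 // => k /andP[kK kST]; rewrite dotZr dotBr cS.
have := H k; rewrite inE kK /= [(k \in T) == _]eq_sym (negPf kST).
by case: eqP => [-> _|_ /(_ isT)//]; rewrite subrr mulr0.
Qed.

(** Sum the facet inequalities of the fixed coordinates; a sum of valid
inequalities is tight exactly where all of them are. *)
Lemma subcube_tight n K (p : {set I} -> 'rV[R]_n) V :
  cubical K p -> is_subcube K V -> exists c b, valid p c b /\ V = tight p c b.
Proof.
move=> [_ facet] [->|[E [S [/fintype.subsetP EK ->]]]].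
  exists 0, 1; split=> [S|]; first by rewrite dotC dot0r.
  by apply/setP => S; rewrite !inE dotC dot0r eq_sym oner_eq0.
have /choice[f fP] : forall k, exists cb : 'rV[R]_n * R, k \in K -> forall T,
    dot cb.1 (p T) <= cb.2 ?= iff ((k \in T) == (k \in S)).
  move=> k; have [kK|] := boolP (k \in K); last by exists (0, 0).
  by have [c [b cb]] := facet k (k \in S) kK; exists (c, b).
have H T : dot (\sum_(k in E) (f k).1) (p T) <= \sum_(k in E) (f k).2
    ?= iff [forall (k | k \in E), (k \in T) == (k \in S)].
  by rewrite dot_suml; apply: leif_sum => k kE; apply: fP; apply: EK.
exists (\sum_(k in E) (f k).1), (\sum_(k in E) (f k).2); split.
  by move=> T; apply: (leif_le (H T)).
by apply/setP => T; rewrite !inE (eq_leif (H T)).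
Qed.

Lemma faces_cubical n K (p : {set I} -> 'rV[R]_n) F :
  cubical K p -> faces (hull p [set: {set I}]%SET) F ->
  F = hull p (vertex_set p F) /\ is_subcube K (vertex_set p F).
Proof.
move=> cp /facesP[c [b [v ->]]]; rewrite vertex_set_hull //; split=> //.
exact: tight_subcube.
Qed.

Lemma subcube_face n K (p : {set I} -> 'rV[R]_n) V :
  cubical K p -> is_subcube K V ->
  faces (hull p [set: {set I}]%SET) (hull p V) /\ vertex_set p (hull p V) = V.
Proof.
move=> cp /(subcube_tight cp)[c [b [v ->]]]; rewrite vertex_set_hull //; split=> //.
by apply/facesP; exists c, b.
Qed.

(** Faces are the hulls of the families indexed by the subcubes, for p and for q
alike, and inclusion of faces is inclusion of the index sets. *)
Lemma comb_equiv_cubical m n K (p : {set I} -> 'rV[R]_m) (q : {set I} -> 'rV[R]_n) :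
  cubical K p -> cubical K q ->
  comb_equiv (hull p [set: {set I}]%SET) (hull q [set: {set I}]%SET).
Proof.
move=> cp cq; exists (fun F => hull q (vertex_set p F)).
have vertex_setS n' (p' : {set I} -> 'rV[R]_n') F G : F `<=` G -> vertex_set p' F \subset vertex_set p' G.
  by move=> FG; apply/fintype.subsetP => S /vertex_setP FS; apply/vertex_setP/(FG _ FS).
have vq F : faces (hull p [set: {set I}]%SET) F -> vertex_set q (hull q (vertex_set p F)) = vertex_set p F.
  by move=> /(faces_cubical cp)[_ /(subcube_face cq)[]].
split; first split.
- by move=> F /(faces_cubical cp)[_ /(subcube_face cq)[]].
- move=> F G /set_mem fF /set_mem fG /(congr1 (vertex_set q)); rewrite !vq // => E.
  by have [-> _] := faces_cubical cp fF; have [-> _] := faces_cubical cp fG; rewrite E.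
- move=> G /(faces_cubical cq)[GE sG].
  have [fF vF] := subcube_face cp sG; exists (hull p (vertex_set q G)) => //.
  by rewrite vF -GE.
move=> F G fF fG; split=> [/vertex_setS FG|/vertex_setS FG]; first exact: hull_subset.
have [-> _] := faces_cubical cp fF; have [-> _] := faces_cubical cp fG.
by apply: hull_subset; move: (FG q); rewrite !vq.
Qed.

Definition cube_vertex K S : 'rV[R]_#|K| := \row_(j < #|K|) (enum_val j \in S)%:R.

Lemma dot_delta n (j : 'I_n) (x : 'rV[R]_n) : dot (delta_mx 0 j) x = x 0 j.
Proof.
rewrite /dot (bigD1 j) //= big1 ?addr0 => [|i ij]; first by rewrite mxE !eqxx mul1r.
by rewrite mxE (negPf ij) andbF mul0r.
Qed.

Lemma cubical_cube K : cubical K (cube_vertex K).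
Proof.
split=> [S T|k e kK].
  exists (fun=> 1); split=> [k|]; first exact: ltr01.
  apply/rowP => j; rewrite summxE !mxE.
  under eq_bigr => k do rewrite scale1r !mxE inE.
  have jK := enum_valP j.
  have [ST|ST] := eqVneq (enum_val j \in S) (enum_val j \in T).
    rewrite ST subrr big1 // => k /andP[kK kST]; case: eqP => [kj|_]; last by rewrite addFb subrr.
    by rewrite -kj ST eqxx in kST.
  rewrite (bigD1 (enum_val j)) ?jK //= eqxx addTb big1 ?addr0.
    by move: ST; case: (_ \in S); case: (_ \in T); rewrite ?subr0 ?sub0r.
  by move=> k /andP[_ kj]; rewrite eq_sym (negPf kj) addFb subrr.
pose j := enum_rank_in kK k.
have vk S : dot (delta_mx 0 j) (cube_vertex K S) = (k \in S)%:R.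
  by rewrite dot_delta mxE enum_rankK_in.
case: e; [exists (delta_mx 0 j), 1|exists (- delta_mx 0 j), 0] => S;
  rewrite ?dotNl vk; case: (k \in S); split; rewrite ?ler01 ?eqxx ?oppr0 ?lexx //.
- by rewrite eq_sym oner_eq0.
- by rewrite oppr_eq0 oner_eq0.
- exact: eqxx.
Qed.

(** A point of the cube is pushed to the vertices one coordinate at a time: it lies
between the points obtained by setting that coordinate to 1 and to 0. *)
Lemma hull_cube K : hull (cube_vertex K) [set: {set I}]%SET = cube R #|K|.
Proof.
apply/seteqP; split.
  apply: convex_hull_sub.
    apply/convex_setP => x y t t0 t1 /= Hx Hy i; rewrite !mxE.
    by have /andP[? ?] := Hx i; have /andP[? ?] := Hy i; apply/andP; split; nra.
  by move=> _ [S _ <-] i; rewrite mxE; case: (_ \in _); rewrite ?lexx ?ler01.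
(* Induction on m, the number of leading coordinates that may be fractional. *)
suff H m : forall x, cube R #|K| x ->
    (forall j : 'I_#|K|, (m <= j)%N -> x 0 j = 0 \/ x 0 j = 1) ->
    hull (cube_vertex K) [set: {set I}]%SET x.
  by move=> x /(H #|K|); apply=> j; rewrite leqNgt ltn_ord.
elim: m => [x _ x01|m IH x cx x01].
  apply: sub_convex_hull; exists [set k | [exists j, (k == enum_val j) && (x 0 j == 1)]]%SET.
    by rewrite /= inE.
  apply/rowP => j; rewrite mxE inE; case: existsP => [[i /andP[/eqP/enum_val_inj -> /eqP] //]|no].
  have [//|xj] := x01 j isT; case: no; exists j; rewrite eqxx xj; exact: eqxx.
have [mK|Km] := ltnP m #|K|; last first.
  by apply: IH => // j /(leq_trans Km); rewrite leqNgt ltn_ord.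
pose j0 := Ordinal mK; pose sub r : 'rV[R]_#|K| := \row_j (if j == j0 then r else x 0 j).
have subP (r : R) : 0 <= r <= 1 -> (r = 0 \/ r = 1) -> hull (cube_vertex K) [set: {set I}]%SET (sub r).
  move=> rI r01; apply: IH => j; rewrite mxE; case: eqP => // jj0 mj.
  apply: x01; rewrite ltn_neqAle mj andbT; apply/eqP => mj'.
  by apply: jj0; apply: val_inj.
have -> : x = x 0 j0 *: sub 1 + (1 - x 0 j0) *: sub 0.
  apply/rowP => j; rewrite !mxE; case: eqP => [->|_]; ring.
have /andP[x0 x1] := cx j0.
apply: (proj1 (convex_setP _) (@convex_hull_convex _ _ _)) => //; apply: subP; rewrite ?lexx ?ler01 //.
  by right.
by left.
Qed.

End Cubical.

(** * Building cubical families *)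

Section CubicalConstructions.
Local Open Scope classical_set_scope.
Local Open Scope ring_scope.
Variables (R : realType) (I : finType) (n : nat).
Implicit Types (K S T : {set I}) (p : {set I} -> 'rV[R]_n).

Lemma cubical_const K (x : 'rV[R]_n) : K = finset.set0 -> cubical K (fun=> x).
Proof.
move=> ->; split=> [S T|k e]; last by rewrite inE.
exists (fun=> 1); split=> [k|]; first exact: ltr01.
by rewrite subrr big_pred0 // => k; rewrite inE.
Qed.

Lemma cubical_perm K p (s : 'S_n) :
  cubical K p -> cubical K (fun S => col_perm s (p S)).
Proof.
move=> [cone facet]; split=> [S T|k e kK].
  have [a [a0 E]] := cone S T; exists a; split=> //.
  by rewrite -linearB E linear_sum; apply: eq_bigr => k _; rewrite linearZ linearB.
have [c [b H]] := facet k e kK; exists (col_perm s c), b => S.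
suff -> : dot (col_perm s c) (col_perm s (p S)) = dot c (p S) by [].
by rewrite /dot [RHS](reindex_inj (@perm_inj _ s)); apply: eq_bigr => i _; rewrite !mxE.
Qed.

Lemma cubical_toggle_out K p k S : cubical K p -> k \notin K -> p (toggle k S) = p S.
Proof.
move=> [cone _] kK; have [a [_ /eqP]] := cone S (toggle k S).
rewrite big1 ?subr_eq0 => [/eqP //|j /andP[jK]]; rewrite inE.
by case: (j =P k) kK => [<-|_ _]; rewrite ?jK // addFb eqxx.
Qed.

(** The second base is the image of the first one under the affine map that
moves x by (dot l x) u, so a vector between points of the same base
decomposes as before, with the same coefficients; the coefficient of the new
edge corrects its length, which varies from dot l (p S) to dot l (p T).
The functional h - C vanishes on the first base and equals dot l x at the top of
the edge over x. This yields the new facets, and it allows each old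
inequality to be tilted so as to be constant along u. *)
Lemma cubical_prism K p (i : I) (h l u : 'rV[R]_n) (C : R) :
  cubical K p -> i \notin K ->
  dot h u = 1 -> (forall S, dot h (p S) = C) -> (forall S, 0 < dot l (p S)) ->
  cubical (i |: K)%SET (fun S => p S + ((i \in S)%:R * dot l (p S)) *: u).
Proof.
move=> cp iK hu hp lp; have [cone facet] := cp.
have ki k : k \in K -> (k == i) = false.
  by move=> kK; apply: contraNF iK => /eqP <-.
split=> [S T|k e].
  have [a [a0 E]] := cone S T.
  (* The edge over p S has length dot l (p S), the one over p T dot l (p T). *)
  exists (fun k => if k == i then dot l (p T) / dot l (p S) else a k); split=> [k|].
    by case: ifP => // _; rewrite divr_gt0.
  rewrite (bigID (fun k => k == i)) /=.
  have -> : \sum_(k | ((k \in (i |: K)%SET) && ((k \in S) != (k \in T))) && (k == i))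
      (if k == i then dot l (p T) / dot l (p S) else a k) *:
        (p (toggle k S) + ((i \in toggle k S)%:R * dot l (p (toggle k S))) *: u -
          (p S + ((i \in S)%:R * dot l (p S)) *: u)) =
      (((i \in T)%:R - (i \in S)%:R) * dot l (p T)) *: u.
    have [ST|ST] := eqVneq (i \in S) (i \in T).
      rewrite ST subrr mul0r scale0r big_pred0 // => k.
      by case: (k =P i) => [->|_]; rewrite ?andbF // ST eqxx !andbF.
    rewrite (big_pred1 i) => [|k]; last first.
      by rewrite !inE; case: (k =P i) => [->|_]; rewrite ?ST ?andbF.
    rewrite eqxx (cubical_toggle_out _ cp iK) inE eqxx addTb.
    rewrite opprD addrACA subrr add0r -scalerBl scalerA; congr (_ *: _).
    have := lp S; move: ST; case: (i \in S); case: (i \in T) => // _ lS; field; exact: lt0r_neq0.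
  have -> : \sum_(k | ((k \in (i |: K)%SET) && ((k \in S) != (k \in T))) && (k != i))
      (if k == i then dot l (p T) / dot l (p S) else a k) *:
        (p (toggle k S) + ((i \in toggle k S)%:R * dot l (p (toggle k S))) *: u -
          (p S + ((i \in S)%:R * dot l (p S)) *: u)) =
      p T - p S + ((i \in S)%:R * dot l (p T - p S)) *: u.
    rewrite E dot_sumr [in RHS]mulr_sumr [in RHS]scaler_suml -big_split /=; apply: eq_big => k.
      rewrite !inE; case: (boolP (k \in K)) => [/ki ->|]; rewrite ?andbT ?orbT //.
      by rewrite orbF; case: (k =P i); rewrite ?andbF.
    case/andP=> _ /negPf kni; rewrite kni inE eq_sym kni addFb.
    rewrite opprD addrACA -scalerBl -mulrBr -dotBr scalerDr dotZr !scalerA.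
    by congr (_ + _ *: _); ring.
  rewrite [RHS]addrC -[RHS]addrA -scalerDl dotBr opprD addrACA -scalerBl.
  by congr (_ + _ *: _); ring.
rewrite in_setU1; case: (k =P i) => [-> _|_ /= kK]; last first.
  (* Tilt c along h so that it becomes orthogonal to u. *)
  have [c [b H]] := facet k e kK; exists (c - dot c u *: h), (b - dot c u * C) => S.
  rewrite dotBl dotZl !dotDr !dotZr hu hp.
  have -> : dot c (p S) + (i \in S)%:R * dot l (p S) * dot c u -
    dot c u * (C + (i \in S)%:R * dot l (p S) * 1) = dot c (p S) - dot c u * C by ring.
  by rewrite /Order.leif lerD2r (inj_eq (addIr _)); exact: H.
case: e.
  (* The gap of this inequality is the value of l at the base point below x,
     which is x - (h x - C) u, minus the height h x - C of x above it. *)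
  exists ((dot l u + 1) *: h - l), ((dot l u + 1) * C) => S.
  rewrite dotBl dotZl !dotDr !dotZr hu hp; have := lp S.
  case: (i \in S) => lS; rewrite ?mulr1n ?mulr0n; split.
  - by rewrite -subr_ge0 le_eqVlt; apply/orP; left; apply/eqP; ring.
  - by rewrite eqxx; apply/eqP; ring.
  - by nra.
  - by apply/eqP => ?; nra.
(* The first base is where the height h x - C is zero. *)
exists (- h), (- C) => S; rewrite dotNl dotDr dotZr hp hu mulr1; have := lp S.
case: (i \in S) => lS; rewrite ?mulr1n ?mulr0n; split.
- by lra.
- by apply/eqP => ?; lra.
- by lra.
- by rewrite eqxx; apply/eqP; ring.
Qed.

End CubicalConstructions.

(** * The points of a Bruhat interval *)

Section BruhatInterval.
Local Open Scope classical_set_scope.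
Local Open Scope ring_scope.
Variables (R : realType) (n : nat).
Implicit Types (z : 'S_n) (i : 'I_n.-1) (ls vs : seq 'I_n.-1).

Lemma perm_point_compp z (s : 'S_n) :
  perm_point R (compp z s) = col_perm s (perm_point R z).
Proof. by apply/rowP => j; rewrite !mxE comppE. Qed.

Lemma perm_point_simple z i :
  perm_point R (compp z (simple i)) = perm_point R z +
    dot (delta_mx 0 (hi i) - delta_mx 0 (lo i)) (perm_point R z) *:
      (delta_mx 0 (lo i) - delta_mx 0 (hi i)).
Proof.
have hl : hi i == lo i = false by rewrite -val_eqE /= gtn_eqF.
apply/rowP => j; rewrite dotBl !dot_delta !mxE comppE eqxx /simple -/(lo i) -/(hi i).
case: tpermP => [->|->|/eqP/negPf -> /eqP/negPf ->] /=.
- by rewrite eqxx eq_sym hl ?mulr1n ?mulr0n; ring.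
- by rewrite eqxx hl ?mulr1n ?mulr0n; ring.
- by rewrite ?mulr0n; ring.
Qed.

(** Reindex along z, which permutes the first positions among themselves. *)
Lemma initial_stable_sum z i : initial_stable i z ->
  dot (\row_j (j <= i)%N%:R) (perm_point R z) = \sum_(j < n | (j <= i)%N) j.+1%:R.
Proof.
move=> st; rewrite [RHS](reindex_inj (@perm_inj _ z)) big_mkcond /=.
by apply: eq_bigr => j _; rewrite !mxE st; case: ifP; rewrite ?mul1r ?mul0r.
Qed.

Definition subword_point vs ls (S : {set 'I_n.-1}) :=
  perm_point R (word_prod [seq i <- ls | (i \in vs) || (i \in S)]).

Lemma subword_point_rcons vs ls i S :
  subword_point vs (rcons ls i) S =
  if (i \in vs) || (i \in S) then col_perm (simple i) (subword_point vs ls S)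
  else subword_point vs ls S.
Proof.
rewrite /subword_point filter_rcons -perm_point_compp; case: ifP => // _.
by rewrite -cats1 word_prod_cat /= [compp (simple i) _]/compp mul1g.
Qed.

(** Right multiplication by the last letter i swaps two coordinates. The factor
x_(i+1) - x_i is positive because i does not occur earlier, so that the
first i positions hold the smallest values. *)
Lemma cubical_word vs ls :
  uniq ls -> cubical [set i in ls | i \notin vs]%SET (subword_point vs ls).
Proof.
elim/last_ind: ls => [_|ls i IH].
  by apply: (cubical_const (perm_point R 1)); apply/setP => i; rewrite !inE.
rewrite rcons_uniq => /andP[ils /IH cls].
have [iv|iv] := boolP (i \in vs).
  have -> : [set j in rcons ls i | j \notin vs]%SET = [set j in ls | j \notin vs]%SET.
    by apply/setP => j; rewrite !inE mem_rcons inE; case: eqP => // ->; rewrite iv !andbF.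
  have -> : subword_point vs (rcons ls i) =
      fun S => col_perm (simple i) (subword_point vs ls S).
    by apply/funext => S; rewrite subword_point_rcons iv.
  exact: cubical_perm.
have -> : [set j in rcons ls i | j \notin vs]%SET = (i |: [set j in ls | j \notin vs])%SET.
  by apply/setP => j; rewrite !inE mem_rcons inE; case: eqP => // ->; rewrite iv.
have st (S : {set 'I_n.-1}) : initial_stable i (word_prod [seq i <- ls | (i \in vs) || (i \in S)]).
  by apply: initial_stable_word; rewrite mem_filter negb_and ils orbT.
have -> : subword_point vs (rcons ls i) = (fun S => subword_point vs ls S +
    ((i \in S)%:R * dot (delta_mx 0 (hi i) - delta_mx 0 (lo i)) (subword_point vs ls S)) *:
      (delta_mx 0 (lo i) - delta_mx 0 (hi i))).
  apply/funext => S; rewrite subword_point_rcons (negPf iv) /=.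
  case: (i \in S); rewrite ?mul1r ?mul0r ?scale0r ?addr0 //.
  by rewrite -perm_point_compp perm_point_simple.
apply: (@cubical_prism _ _ _ _ _ _ (\row_j (j <= i)%N%:R) _ _
  (\sum_(j < n | (j <= i)%N) j.+1%:R)) => //.
- by rewrite inE (negPf ils).
- by rewrite dotC dotBl !dot_delta !mxE /= leqnn ltnn subr0.
- by move=> S; apply: initial_stable_sum.
- move=> S; rewrite dotBl !dot_delta !mxE subr_gt0 ltr_nat ltnS.
  apply: (@leq_ltn_trans i); first by rewrite st /=.
  by rewrite ltnNge st /= -ltnNge.
Qed.

Lemma comb_equiv_cube_word vs ls : uniq ls -> subseq vs ls ->
  comb_equiv_cube (bruhat_polytope R (word_prod vs) (word_prod ls)).
Proof.
move=> us ss; set K := [set i in ls | i \notin vs]%SET; exists #|K|.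
have -> : bruhat_polytope R (word_prod vs) (word_prod ls) =
    hull (subword_point vs ls) [set: _]%SET.
  congr convex_hull; apply/seteqP; split=> x.
    by move=> [z /(bruhat_interval_word _ us ss)[S ->] <-]; exists S; rewrite //= inE.
  move=> [S _ <-]; eexists; last reflexivity.
  by apply/(bruhat_interval_word _ us ss); exists S.
rewrite -hull_cube; apply: (@comb_equiv_cubical _ _ _ _ K); last exact: cubical_cube.
exact: cubical_word.
Qed.

End BruhatInterval.

Theorem proposition7p9 (R : realType) (n : nat) :
  (forall w : 'S_n,
     (exists ls : seq 'I_n.-1, uniq ls /\ w = word_prod ls) ->
     forall v : 'S_n, bruhat_lt v w -> comb_equiv_cube (bruhat_polytope R v w))
  /\
  (forall (v w : 'S_n) (js : seq 'I_n.-1),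
     w = compp v (word_prod js) ->
     ell w = (ell v + size js)%N ->
     uniq js ->
     (exists is_ : seq 'I_n.-1, reduced_expr v is_ /\ uniq (is_ ++ js)) ->
     comb_equiv_cube (bruhat_polytope R v w)).
Proof.
split=> [w [ls [us ->]] v /andP[_ /bruhat_le_word[vs ss ->]]|].
  exact: comb_equiv_cube_word.
move=> v w js -> _ _ [vs [[-> _] us]].
by rewrite -word_prod_cat; apply: comb_equiv_cube_word (prefix_subseq _ _).
Qed.
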